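(* For all $n>3$, $$\begin{aligned}\sum_{\pi\in\mathfrak{S}_n,\ \mathcal{T}^{n-3}(\pi)=\mathrm{id}} x^{1+\mathrm{des}(\pi)} \;=\;& A_n(x)-A_{\lfloor\frac{n-1}{2}\rfloor}(x)\,A_{\lceil\frac{n-1}{2}\rceil}(x)\\ &-\left\lfloor\tfrac{n+2}{2}\right\rfloor A_{\lfloor\frac{n-1}{2}\rfloor}(x)\,A_{\lfloor\frac n2\rfloor}(x)-\left\lfloor\tfrac{n-1}{2}\right\rfloor A_{\lfloor\frac{n-2}{2}\rfloor}(x)\,A_{\lfloor\frac{n+1}{2}\rfloor}(x)\\ &+A_{\lfloor\frac{n-1}{2}\rfloor}(x)\,D_{\lfloor\frac n2\rfloor}(x)-A_{\lfloor\frac{n-2}{2}\rfloor}(x)\,D_{\lfloor\frac{n+1}{2}\rfloor}(x),\end{aligned}$$ where $$D_m(x)=\frac12\sum_{i=0}^{m-1}\binom{m-1}{i}A_i(x)\,A_{m-1-i}(x).$$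
   Context: $\mathfrak{S}_n$ is the set of permutations of $\{1,\ldots,n\}$, written as words; $\mathrm{id}=12\cdots n$; $\mathrm{des}(\pi)$ is the number of indices $i$ with $\pi_i>\pi_{i+1}$. $A_m(x)=\sum_{\pi\in\mathfrak{S}_m}x^{1+\mathrm{des}(\pi)}$ for $m\ge 1$ is the $m$th Eulerian polynomial, and $A_0(x)=1$. The operator $\mathcal{T}$ (revstack sort) is defined recursively on finite words of distinct positive integers by $\mathcal{T}(\epsilon)=\epsilon$ for the empty word $\epsilon$, $\mathcal{T}(y)=y$ for a word $y$ of length 1, and $\mathcal{T}(LmR)=\mathcal{T}(R)\,\mathcal{T}(L)\,m$, where $m$ is the largest entry of $LmR$; $\mathcal{T}^{t}$ is its $t$-fold iterate. *)

(* Defs.v *)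
From mathcomp Require Import all_boot all_order all_fingroup all_algebra.

Set Implicit Arguments.
Unset Strict Implicit.
Unset Printing Implicit Defensive.

Import GRing.Theory.

(* 'S_n acts on {0, ..., n-1}; values are shifted by one so that the word has
   letters 1, ..., n. *)
Definition word n (s : 'S_n) : seq nat := [seq (s i).+1 | i : 'I_n].

Definition id_word n : seq nat := iota 1 n.

Lemma word1 n : word (1%g : 'S_n) = id_word n.
Proof.
rewrite /word /id_word /image_mem (iotaDl 1 0) -val_enum_ord -map_comp.
by apply: eq_map => i /=; rewrite perm1 add1n.
Qed.

Definition des (w : seq nat) : nat :=
  #|[set i : 'I_(size w).-1 | nth 0 w i > nth 0 w i.+1]|.

Definition word_max (w : seq nat) : nat := \max_(a <- w) a.

(* The first argument is fuel: it only makes the recursion structural. By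
   revstack_catE below, size w steps are enough for the word w. *)
Fixpoint revstack_rec (k : nat) (w : seq nat) : seq nat :=
  if k is k'.+1 then
    if w is [::] then [::] else
    let m := word_max w in
    let L := take (index m w) w in
    let R := drop (index m w).+1 w in
    revstack_rec k' R ++ revstack_rec k' L ++ [:: m]
  else [::].

Definition revstack (w : seq nat) : seq nat := revstack_rec (size w) w.

Section RevstackRecursion.

Implicit Types (k l m : nat) (w L R : seq nat).

Lemma word_max_in w : w != [::] -> word_max w \in w.
Proof.
rewrite /word_max; elim: w => // a w IHw _; rewrite big_cons in_cons.
case: w IHw => [_|b w /(_ isT) IHw]; first by rewrite big_nil maxn0 eqxx.
by case: leqP => _; rewrite ?eqxx ?IHw ?orbT.
Qed.

Lemma revstack_recS k w (m := word_max w) (j := index m w) : w != [::] ->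
  revstack_rec k.+1 w =
    revstack_rec k (drop j.+1 w) ++ revstack_rec k (take j w) ++ [:: m].
Proof. by case: w @m @j. Qed.

Lemma revstack_rec_fuel k l w :
  size w <= k -> size w <= l -> revstack_rec k w = revstack_rec l w.
Proof.
elim: k l w => [|k IHk] [|l] [|a w] // wk wl.
rewrite !revstack_recS //; set m := word_max _; set j := index _ _.
have jw : j < size (a :: w) by rewrite index_mem word_max_in.
have sR : size (drop j w) <= size w by rewrite size_drop leq_subr.
have sL : size (take j (a :: w)) <= size w by rewrite size_take jw -ltnS.
by congr (_ ++ (_ ++ _)); apply: IHk;
  apply: leq_trans (_ : size w <= _) => //; rewrite -ltnS.
Qed.

Lemma revstack0 : revstack [::] = [::].
Proof. by []. Qed.

Lemma revstack1 a : revstack [:: a] = [:: a].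
Proof. by rewrite /revstack revstack_recS // /word_max big_seq1. Qed.

Lemma revstack_catE L m R : all (gtn m) (L ++ R) ->
  revstack (L ++ m :: R) = revstack R ++ revstack L ++ [:: m].
Proof.
rewrite all_cat => /andP[Lm Rm].
have maxE : word_max (L ++ m :: R) = m.
  have le_m s : all (gtn m) s -> \max_(a <- s) a <= m.
    elim: s => [|x s IHs] /=; first by rewrite big_nil.
    by rewrite big_cons geq_max => /andP[/ltnW-> /IHs].
  rewrite /word_max big_cat big_cons /=.
  by rewrite (maxn_idPl (le_m _ Rm)) (maxn_idPr (le_m _ Lm)).
have mL : m \notin L.
  by apply/negP => /(allP Lm); rewrite /= ltnn.
have idxE : index m (L ++ m :: R) = size L.
  by rewrite index_cat (negPf mL) /= eqxx addn0.
rewrite /revstack [in LHS]size_cat addnS.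
rewrite revstack_recS; last by case: (L).
rewrite maxE idxE take_size_cat // -cat_rcons drop_size_cat ?size_rcons //.
by congr (_ ++ (_ ++ _)); apply: revstack_rec_fuel;
  rewrite // ?leq_addl ?leq_addr.
Qed.

End RevstackRecursion.

Local Open Scope ring_scope.

(* For m = 0 the sum would be 'X, so A_0 = 1 is set separately. *)
Definition eulerian (m : nat) : {poly rat} :=
  if m is 0 then 1 else \sum_(s : 'S_m) 'X^(1 + des (word s)).

Definition half_binom_conv (m : nat) : {poly rat} :=
  (1 / 2%:R) *:
    \sum_(i < m) 'C(m.-1, i)%:R *: (eulerian i * eulerian (m.-1 - i)%N).

(* Main.v *)
Require Import Defs.
From mathcomp Require Import all_boot all_order all_fingroup all_algebra.
From mathcomp Require Import zify ring.

Set Implicit Arguments.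
Unset Strict Implicit.
Unset Printing Implicit Defensive.

(** The sum over all permutations is A_n, so the task is to describe the words
    w of size n with T^(n-3)(w) <> id and to sum x^(1 + des) over them.  Since
    T(L n R) = T(R) T(L) n and the last letter n never moves again, L n R is
    such a word if and only if T(R) T(L) is one of size n - 1.  Every nonempty
    image of T ends in its largest letter; this makes the recursion
    so restrictive that it can be solved.  Write P_m for the set of letters
    m, m - 2, m - 4, ... and let n >= 3.  The solutions are

    - rigid words L n R: the sets of letters of L and of R are prescribed, and
      both words are otherwise arbitrary.  The allowed pairs of sets are those
      of [rigid_splits n]: the new pair (P_(n-1), P_(n-2)), and each pair (S, S')
      of size n - 1 turned into (S', S + {n-1}), because T exchanges the sides;
    - words U (n-1) V with U an arrangement of P_(n-3) and V an arrangement of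
      P_n in which n - 2 precedes n;
    - words U (n-1) V with V an arrangement of P_(n-2) and U an arrangement of
      P_(n-3) + {n} in which n precedes n - 3.

    [unsortedP] proves this by induction on n, according to the side of n on
    which n - 1 lies; for n = 3 every word except 123 is listed.

    For n >= 4 the three kinds, and the rigid words for different splits, are
    disjoint, so their contributions add up.  In all of them the word is cut at
    a letter c that has a left neighbour and exceeds its neighbours, and then
    x^(1 + des) is multiplicative ([wt_peak]).  A rigid split thus gives a
    product of two Eulerian polynomials.  In the other two kinds one factor counts words over
    a set of m letters by whether a given letter a precedes the maximum M.
    Exchanging the two sides of M matches those with a on the left with those
    with a on the right and keeps the product of the weights of the two sides,
    so each half is half of the sum of A_i A_(m-1-i) over all choices of a left
    side, which is D_m ([sum_before]).
    The arrangements of the opposite order therefore contribute A_m - D_m. *)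

(** * Parts of a word *)

Lemma perm_cat_compl (T : eqType) (a b c d : seq T) :
  perm_eq (a ++ b) (c ++ d) -> perm_eq a c = perm_eq b d.
Proof.
move=> abcd; apply/idP/idP => [ac | bd].
  by rewrite -(perm_cat2l a) (perm_trans abcd) // perm_cat2r perm_sym.
by rewrite -(perm_cat2r b) (perm_trans abcd) // perm_cat2l perm_sym.
Qed.

Definition left_part (m : nat) (w : seq nat) : seq nat := take (index m w) w.

Definition before (a b : nat) (w : seq nat) : bool := index a w < index b w.

Lemma left_part_cat m u v : m \notin u -> left_part m (u ++ m :: v) = u.
Proof.
by move=> mu; rewrite /left_part index_cat (negPf mu) /= eqxx addn0 take_size_cat.
Qed.

Lemma before_pivot a b u v : b \notin u -> before a b (u ++ b :: v) = (a \in u).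
Proof.
move=> bu; rewrite /before !index_cat (negPf bu) /= eqxx addn0.
by case: ifP => au; [rewrite index_mem | rewrite ltnNge leq_addr].
Qed.

Lemma pivot_before a b u v : b \notin u -> a != b ->
  before b a (u ++ b :: v) = (a \notin u).
Proof.
move=> bu ab; rewrite /before !index_cat (negPf bu) /= eqxx addn0.
rewrite eq_sym (negPf ab); case: ifP => au.
  by rewrite ltnNge ltnW // index_mem.
by rewrite -{1}[size u]addn0 ltn_add2l.
Qed.

Lemma before_cat2 a b u v : a \in u -> b \in u -> before a b (u ++ v) = before a b u.
Proof. by move=> au bu; rewrite /before !index_cat au bu. Qed.

Lemma before_shift a b x u v : a \notin x :: u -> b \notin x :: u ->
  before a b (u ++ x :: v) = before a b v.
Proof.
rewrite !in_cons !negb_or /before !index_cat /= =>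
  /andP[ax /negPf->] /andP[bx /negPf->].
by rewrite ![x == _]eq_sym (negPf ax) (negPf bx) ltn_add2l ltnS.
Qed.

(** * The revstack operator *)

Lemma revstack_max w m : uniq w -> m \in w -> {in w, forall x, x <= m} ->
  exists L R, [/\ w = L ++ m :: R, all (gtn m) (L ++ R)
                & revstack w = revstack R ++ revstack L ++ [:: m]].
Proof.
move=> uw mw; case/splitPr: mw uw => L R uw le_m; exists L, R.
have lt_m : all (gtn m) (L ++ R).
  apply/allP=> x xLR /=; rewrite ltn_neqAle le_m ?andbT; last first.
    by move: xLR; rewrite !mem_cat in_cons => /orP[] ->; rewrite ?orbT.
  apply: contraTneq xLR => ->.
  by move: uw; rewrite cat_uniq /= negb_or mem_cat =>
    /and3P[_ /andP[mL _] /andP[mR _]]; rewrite negb_or mL.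
by split=> //; apply: revstack_catE.
Qed.

Lemma word_max_ge w x : x \in w -> x <= word_max w.
Proof. by move=> xw; rewrite /word_max; apply: leq_bigmax_seq. Qed.

Lemma perm_revstack w : uniq w -> perm_eq (revstack w) w.
Proof.
have [N] := ubnP (size w); elim: N w => // N IHN w ltN uw.
have [-> // | w0] := eqVneq w [::].
have [L [R [wE _ ->]]] := revstack_max uw (word_max_in w0) (@word_max_ge w).
set m := word_max w in wE *.
have [uL uR] : uniq L /\ uniq R.
  by move: uw; rewrite wE cat_uniq /= => /and3P[-> _ /andP[_ ->]].
have szw : size w = (size L + size R).+1 by rewrite wE size_cat addnS.
have pR : perm_eq (revstack R) R by apply: IHN => //; lia.
have pL : perm_eq (revstack L) L by apply: IHN => //; lia.
rewrite wE perm_catC -catA; apply: perm_cat => //.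
by rewrite cat1s perm_cons.
Qed.

Lemma mem_revstack w : uniq w -> revstack w =i w.
Proof. by move=> uw; apply/perm_mem/perm_revstack. Qed.

(** The source of all rigidity below: an image of [revstack] ends in its maximum,
    so where that maximum sits in a concatenation of images reveals which factor
    contained it. *)
Lemma revstack_last w m : uniq w -> m \in w -> {in w, forall x, x <= m} ->
  exists2 u, revstack w = u ++ [:: m] & perm_eq w (m :: u).
Proof.
move=> uw mw le_m; have [L [R [_ _ Tw]]] := revstack_max uw mw le_m.
exists (revstack R ++ revstack L); first by rewrite Tw catA.
rewrite perm_sym -cat1s perm_catC -catA -Tw; exact: perm_revstack.
Qed.

(** * Parity classes and rigid splits *)

(** The letters of the parity of [n] up to [n], the largest first so that
    removing the maximum leaves [parity_class (n - 2)] definitionally. *)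
Fixpoint parity_class (n : nat) : seq nat :=
  match n with
  | 0 => [::]
  | 1 => [:: 1]
  | n'.+2 => n :: parity_class n'
  end.

Lemma parity_classSS n : parity_class n.+2 = n.+2 :: parity_class n.
Proof. by []. Qed.

Lemma two_step_ind (P : nat -> Prop) :
  P 0 -> P 1 -> (forall n, P n -> P n.+2) -> forall n, P n.
Proof.
move=> P0 P1 PSS n; suff: P n /\ P n.+1 by case.
by elim: n => // n [Pn PSn]; split=> //; apply: PSS.
Qed.

Lemma size_parity_class n : size (parity_class n) = uphalf n.
Proof. by elim/two_step_ind: n => //= n ->. Qed.

Lemma mem_parity_class x n :
  (x \in parity_class n) = (0 < x <= n) && (odd x == odd n).
Proof.
elim/two_step_ind: n => [||n IHn]; [rewrite in_nil; lia | rewrite mem_seq1; lia |].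
rewrite parity_classSS in_cons IHn; lia.
Qed.

Lemma parity_class_uniq n : uniq (parity_class n).
Proof.
elim/two_step_ind: n => // n IHn.
by rewrite parity_classSS cons_uniq IHn mem_parity_class andbT; lia.
Qed.

Lemma perm_parity_class n :
  perm_eq (parity_class n.+1 ++ parity_class n) (iota 1 n.+1).
Proof.
apply: uniq_perm => [||x]; rewrite ?iota_uniq //.
  rewrite cat_uniq !parity_class_uniq andbT; apply/hasPn => x;
    rewrite !mem_parity_class; lia.
by rewrite mem_cat !mem_parity_class mem_iota; lia.
Qed.

Lemma perm_iotaS n : perm_eq (n.+1 :: iota 1 n) (iota 1 n.+1).
Proof. by rewrite -(addn1 n) iotaD add1n -cat1s perm_catC addn1. Qed.

(** The pairs of letter sets around the maximum [n] that alone force a word to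
    stay unsorted.  The recursion reflects [L n R |-> T(R) T(L)]: if [n - 1] lies
    in [R], it ends the block [T(R)], so [L] is what stands to the right of
    [n - 1] in the image. *)
Fixpoint rigid_splits (n : nat) : seq (seq nat * seq nat) :=
  if n is n'.+1 then
    (parity_class n', parity_class n'.-1)
      :: [seq (p.2, n' :: p.1) | p <- rigid_splits n']
  else [::].

Lemma rigid_splitsS n :
  rigid_splits n.+1 =
    (parity_class n, parity_class n.-1)
      :: [seq (p.2, n :: p.1) | p <- rigid_splits n].
Proof. by []. Qed.

Lemma rigid_splits_perm n p :
  p \in rigid_splits n -> perm_eq (p.1 ++ p.2) (iota 1 n.-1).
Proof.
elim: n p => // -[|n] IHn p.
  by rewrite inE => /eqP->.
rewrite rigid_splitsS in_cons => /predU1P[-> | /mapP[q /IHn qP ->]].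
  exact: perm_parity_class.
rewrite [_.-1]/= -(permPr (perm_iotaS n)); apply/seq.permP => x; move: qP =>
  /seq.permP/(_ x).
by rewrite /= ?count_cat /= ?count_cat /=; lia.
Qed.

(** * Words that remain unsorted after n - 3 passes *)

(** The three shapes of the words of size [n = k + 3] that [n - 3 = k] passes
    leave unsorted.  In the first, [n - 1] precedes [n]. *)
Definition unsorted_asc k w :=
  perm_eq (left_part k.+2 w) (parity_class k) && before k.+1 k.+3 w.

(** Here [n] precedes [n - 1].  For [n = 3] the letter [n - 3 = 0] is absent and
    its index is the size of the word, so the order condition holds. *)
Definition unsorted_desc k w :=
  perm_eq (left_part k.+2 w) (k.+3 :: parity_class k) && before k.+3 k w.

Definition unsorted_rigid k w :=
  has (fun p => perm_eq (left_part k.+3 w) p.1) (rigid_splits k.+3).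

Definition unsorted k w :=
  [|| unsorted_asc k w, unsorted_desc k w | unsorted_rigid k w].

Lemma perm_notin (T : eqType) (x : T) s t :
  x \in s -> x \notin t -> perm_eq s t = false.
Proof. by move=> xs; apply: contraNF => /perm_mem <-. Qed.

Lemma perm_notin_r (T : eqType) (x : T) s t :
  x \notin s -> x \in t -> perm_eq s t = false.
Proof. by move=> xs; apply: contraTF => /perm_mem <-. Qed.

Lemma has_consE (T : Type) (a : pred T) x s : has a (x :: s) = a x || has a s.
Proof. by []. Qed.

(** If the letter below the maximum is on the right, the split cannot be the one
    created last, and the older ones come from the right sides one size down. *)
Lemma unsorted_rigid_right k (L R : seq nat) : k.+3 \notin L ->
  perm_eq (L ++ R) (iota 1 k.+3) ->
  unsorted_rigid k.+1 (L ++ k.+4 :: R) =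
    has (fun p => perm_eq L p.2) (rigid_splits k.+3).
Proof.
move=> kL LR; rewrite /unsorted_rigid left_part_cat; last first.
  have : k.+4 \notin L ++ R by rewrite (perm_mem LR) mem_iota; lia.
  by rewrite mem_cat negb_or => /andP[].
rewrite rigid_splitsS has_consE.
rewrite (perm_notin_r kL (mem_head _ _)) orFb has_map.
exact: eq_has.
Qed.

(** Only the split created last has the letter below the maximum on the left. *)
Lemma unsorted_rigid_left k (L R : seq nat) : k.+3 \in L ->
  perm_eq (L ++ R) (iota 1 k.+3) ->
  unsorted_rigid k.+1 (L ++ k.+4 :: R) = perm_eq L (parity_class k.+3).
Proof.
move=> kL LR; rewrite /unsorted_rigid left_part_cat; last first.
  have : k.+4 \notin L ++ R by rewrite (perm_mem LR) mem_iota; lia.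
  by rewrite mem_cat negb_or => /andP[].
rewrite rigid_splitsS has_consE.
rewrite has_map [X in _ || X](_ : _ = false) ?orbF //.
apply/hasPn => p pF /=; apply/negbT/(@perm_notin _ k.+3) => //.
have : k.+3 \notin p.1 ++ p.2.
  by rewrite (perm_mem (rigid_splits_perm pF)) mem_iota; lia.
by rewrite mem_cat negb_or => /andP[].
Qed.

(** Used to branch on the block that contains the largest remaining letter. *)
Lemma uniq_cat3P (T : eqType) (x : T) a b c :
  uniq (a ++ b ++ c) -> x \in a ++ b ++ c ->
  [\/ [/\ x \in a, x \notin b & x \notin c],
      [/\ x \notin a, x \in b & x \notin c]
    | [/\ x \notin a, x \notin b & x \in c]].
Proof.
rewrite !cat_uniq has_cat => /and3P[_ abc /and3P[_ bc _]] xabc.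
have h s t : ~~ has (mem s) t -> x \in t -> x \notin s.
  by move=> /hasPn st /st.
move: abc; rewrite negb_or => /andP[/h ab /h ac]; move/h in bc.
move: xabc ab ac bc; rewrite !mem_cat.
case: (x \in a) (x \in b) (x \in c) => [] [] [] //= _;
  do ?[by constructor | by move/(_ isT) | move=> _].
Qed.

(** The case of [k + 3] to the right of the maximum [k + 4].  Rigid words then
    correspond to rigid words, and words of the second shape to words of the first:
    if the prefix of the image up to [k + 2] is an arrangement of the class of
    [k], then [k + 2] must end [revstack Rb], since otherwise that prefix would
    contain [k + 3] or [k + 1].  The image never has the second shape: [k + 3] would be
    to the left of [k + 2], which forces [k + 2] to the end of the word and
    [k + 1] into its left part. *)
Lemma unsorted_step_right k (L Ra Rb : seq nat) :
  perm_eq (L ++ Ra ++ Rb) (iota 1 k.+2) ->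
  unsorted k.+1 (L ++ k.+4 :: Ra ++ k.+3 :: Rb) =
  unsorted k (revstack Rb ++ revstack Ra ++ k.+3 :: revstack L).
Proof.
move=> pw; have mw := perm_mem pw.
have uw : uniq (L ++ Ra ++ Rb) by rewrite (perm_uniq pw) iota_uniq.
have [uL [uRa uRb]] : uniq L /\ uniq Ra /\ uniq Rb.
  by move: uw; rewrite !cat_uniq => /and3P[-> _ /and3P[-> _ ->]].
have big x : k.+2 < x -> [/\ x \notin L, x \notin Ra & x \notin Rb].
  move=> xk; have : x \notin L ++ Ra ++ Rb by rewrite mw mem_iota; move: xk; clear;
    lia.
  by rewrite !mem_cat !negb_or => /and3P[].
have [k3L k3Ra k3Rb] := big k.+3 (ltnSn _).
have [k4L k4Ra k4Rb] := big k.+4 (ltnW (ltnSn _)).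
have TL := mem_revstack uL; have TRa := mem_revstack uRa.
have TRb := mem_revstack uRb.
have pRa := perm_revstack uRa.
have pRb := perm_revstack uRb.
set w := L ++ _; set w' := revstack Rb ++ _.
have w'E : w' = (revstack Rb ++ revstack Ra) ++ k.+3 :: revstack L.
  by rewrite /w' catA.
have wE : w = (L ++ k.+4 :: Ra) ++ k.+3 :: Rb by rewrite /w -catA.
have k3w' : k.+3 \notin revstack Rb ++ revstack Ra.
  by rewrite mem_cat TRb TRa negb_or k3Rb.
have k3w : k.+3 \notin L ++ k.+4 :: Ra.
  by rewrite mem_cat in_cons !negb_or k3L k3Ra andbT; clear; lia.
have k2in : k.+2 \in L ++ Ra ++ Rb by rewrite mw mem_iota; clear; lia.
have k1in : k.+1 \in L ++ Ra ++ Rb by rewrite mw mem_iota; clear; lia.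
have C : unsorted_rigid k.+1 w = unsorted_rigid k w'.
  rewrite unsorted_rigid_right //; last first.
    apply/seq.permP => x; move/seq.permP/(_ x): pw.
    have /seq.permP/(_ x) := perm_iotaS k.+2.
    rewrite /= ?count_cat /= ?count_cat /=; clear; lia.
  rewrite /unsorted_rigid w'E left_part_cat //; apply: eq_in_has =>
    p /rigid_splits_perm /= pF.
  apply: perm_cat_compl.
  apply/seq.permP => x; move/seq.permP/(_ x): pF; move/seq.permP/(_ x): pw.
  move/seq.permP/(_ x): pRa; move/seq.permP/(_ x): pRb.
  rewrite /= ?count_cat /= ?count_cat /=; clear; lia.
have A' : unsorted_asc k.+1 w = false.
  rewrite /unsorted_asc wE left_part_cat // (@perm_notin _ k.+4) //.
    by rewrite mem_cat mem_head orbT.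
  by rewrite mem_parity_class; clear; lia.
have B' : unsorted_desc k.+1 w = perm_eq Rb (parity_class k.+2) && (k.+1 \notin L).
  rewrite /unsorted_desc pivot_before //; last by clear; lia.
  rewrite wE left_part_cat //; congr (_ && _).
  have -> : perm_eq (L ++ k.+4 :: Ra) (k.+4 :: parity_class k.+1) = perm_eq (L ++
    Ra) (parity_class k.+1).
    by rewrite -(cat1s k.+4 Ra) perm_catCA perm_cons.
  apply: perm_cat_compl; rewrite -catA (perm_trans pw) // perm_sym.
  rewrite perm_catC; apply: perm_parity_class.
have ule x : x \in L ++ Ra ++ Rb -> x <= k.+2 by rewrite mw mem_iota; clear; lia.
have leL : {in L, forall x, x <= k.+2}.
  by move=> x xL; apply: ule; rewrite !mem_cat xL.
have leRa : {in Ra, forall x, x <= k.+2}.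
  by move=> x xR; apply: ule; rewrite !mem_cat xR orbT.
have leRb : {in Rb, forall x, x <= k.+2}.
  by move=> x xR; apply: ule; rewrite !mem_cat xR !orbT.
have k1alt : k.+1 \notin parity_class k by rewrite mem_parity_class; clear; lia.
have k3alt : k.+3 \notin parity_class k by rewrite mem_parity_class; clear; lia.
have A1 : before k.+1 k.+3 w' = (k.+1 \notin L).
  rewrite w'E before_pivot // mem_cat TRb TRa.
  by have [] := uniq_cat3P uw k1in => -[-> h1 h2];
    rewrite ?h1 ?h2 ?(negPf h1) ?(negPf h2) ?orbT.
(* The first shape of the image matters only if k + 1 is not in L, because
   otherwise its order condition fails. *)
suff [AR BF] : (k.+1 \notin L ->
    perm_eq (left_part k.+2 w') (parity_class k) = perm_eq Rb (parity_class k.+2)) /\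
    perm_eq (left_part k.+2 w') (k.+3 :: parity_class k) = false.
  rewrite /unsorted A' C B' /unsorted_asc /unsorted_desc BF A1 /=.
  by case: (boolP (k.+1 \in L)) AR => [|_ /(_ isT)->] /=; rewrite ?andbF ?andbT.
have [] := uniq_cat3P uw k2in => -[k2L k2Ra k2Rb].
- have [u Lu pu] := revstack_last uL k2L leL.
  have -> : left_part k.+2 w' = revstack Rb ++ revstack Ra ++ k.+3 :: u.
    rewrite /w' Lu -cat_cons !catA -(cat1s _ [::]) cats0 left_part_cat //.
    rewrite !mem_cat in_cons TRb TRa !negb_or k2Ra k2Rb /=.
    apply/andP; split; first by clear; lia.
    by have := uL; rewrite (perm_uniq pu) => /= /andP[].
  split=> [_|].
    rewrite (perm_notin _ k3alt) ?mem_cat ?mem_head ?orbT //.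
    by rewrite (perm_notin_r k2Rb) // mem_head.
  apply: (@perm_notin _ k.+1).
    move: k1in; rewrite !mem_cat (perm_mem pu) TRb TRa !in_cons.
    by case: (_ \in u); case: (_ \in Ra); case: (_ \in Rb) => //=; clear; lia.
  by rewrite in_cons negb_or k1alt andbT; clear; lia.
- have [u Ru pu] := revstack_last uRa k2Ra leRa.
  have -> : left_part k.+2 w' = revstack Rb ++ u.
    rewrite /w' Ru -catA catA left_part_cat // mem_cat TRb negb_or k2Rb /=.
    by have := uRa; rewrite (perm_uniq pu) => /= /andP[].
  have k3u : k.+3 \notin u.
    by move: k3Ra; rewrite (perm_mem pu) in_cons negb_or => /andP[].
  split=> [k1L|].
    rewrite [RHS](perm_notin_r k2Rb) ?mem_head //.
    apply: (@perm_notin _ k.+1) => //.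
    move: k1in; rewrite !mem_cat (negPf k1L) TRb (perm_mem pu) !in_cons /=.
    by case: (_ \in u); case: (_ \in Rb) => //=; clear; lia.
  apply: (@perm_notin_r _ k.+3); last exact: mem_head.
  by rewrite mem_cat TRb negb_or k3Rb.
- have [u Ru pu] := revstack_last uRb k2Rb leRb.
  have -> : left_part k.+2 w' = u.
    rewrite /w' Ru -catA left_part_cat //.
    by have := uRb; rewrite (perm_uniq pu) => /= /andP[].
  have k3u : k.+3 \notin u.
    by move: k3Rb; rewrite (perm_mem pu) in_cons negb_or => /andP[].
  split=> [_|]; first by rewrite (permPl pu) parity_classSS perm_cons.
  exact: (perm_notin_r k3u (mem_head _ _)).
Qed.

Lemma rigid_splits_right_nonempty k p : p \in rigid_splits k.+3 -> p.2 != [::].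
Proof.
rewrite rigid_splitsS in_cons => /predU1P[-> | /mapP[q _ ->] //].
by rewrite -size_eq0 size_parity_class.
Qed.

(** The case of [k + 3] to the left of the maximum: the image ends in [k + 3],
    so no rigid split applies to it and only the first shape remains, where
    it reduces to a condition on the letters before [k + 2].  Depending on the
    block that ends in [k + 2], this makes the original word rigid (block [R]) or
    of the first shape (block [Lb]); block [La] is impossible. *)
Lemma unsorted_step_left k (La Lb R : seq nat) :
  perm_eq (La ++ Lb ++ R) (iota 1 k.+2) ->
  unsorted k.+1 (La ++ k.+3 :: Lb ++ k.+4 :: R) =
  unsorted k (revstack R ++ revstack Lb ++ revstack La ++ [:: k.+3]).
Proof.
move=> pw; have mw := perm_mem pw.
have uw : uniq (La ++ Lb ++ R) by rewrite (perm_uniq pw) iota_uniq.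
have [uLa [uLb uR]] : uniq La /\ uniq Lb /\ uniq R.
  by move: uw; rewrite !cat_uniq => /and3P[-> _ /and3P[-> _ ->]].
have big x : k.+2 < x -> [/\ x \notin La, x \notin Lb & x \notin R].
  move=> xk; have : x \notin La ++ Lb ++ R by rewrite mw mem_iota; move: xk; clear;
    lia.
  by rewrite !mem_cat !negb_or => /and3P[].
have [k3La k3Lb k3R] := big k.+3 (ltnSn _).
have [k4La k4Lb k4R] := big k.+4 (ltnW (ltnSn _)).
have TLa := mem_revstack uLa; have TLb := mem_revstack uLb.
have TR := mem_revstack uR.
have pLa := perm_revstack uLa; have pLb := perm_revstack uLb.
have pR := perm_revstack uR.
set w := La ++ _; set w' := revstack R ++ _.
have w'E : w' = (revstack R ++ revstack Lb ++ revstack La) ++ [:: k.+3].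
  by rewrite /w' !catA.
have wE : w = (La ++ k.+3 :: Lb) ++ k.+4 :: R by rewrite /w -catA.
have k3w' : k.+3 \notin revstack R ++ revstack Lb ++ revstack La.
  by rewrite !mem_cat TR TLb TLa !negb_or k3R k3Lb.
have k4w : k.+4 \notin La ++ k.+3 :: Lb.
  by rewrite mem_cat in_cons !negb_or k4La k4Lb andbT; clear; lia.
have k2in : k.+2 \in La ++ Lb ++ R by rewrite mw mem_iota; clear; lia.
have k1in : k.+1 \in La ++ Lb ++ R by rewrite mw mem_iota; clear; lia.
have B : unsorted_desc k.+1 w = false.
  rewrite /unsorted_desc /w left_part_cat // (perm_notin_r k4La) //; exact: mem_head.
have C : unsorted_rigid k.+1 w = perm_eq R (parity_class k.+2).
  have pL : perm_eq ((La ++ k.+3 :: Lb) ++ R) (iota 1 k.+3).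
    rewrite -(permPr (perm_iotaS _)); apply/seq.permP => x.
    by move/seq.permP/(_ x): pw; rewrite /= ?count_cat /= ?count_cat /=; clear; lia.
  rewrite wE unsorted_rigid_left //; last by rewrite mem_cat mem_head orbT.
  apply: perm_cat_compl; apply: perm_trans pL _.
  by rewrite perm_sym perm_parity_class.
have A : unsorted_asc k.+1 w =
    perm_eq (Lb ++ R) (parity_class k.+2) && (k.+2 \in La ++ Lb).
  rewrite /unsorted_asc {1}/w left_part_cat // wE before_pivot // !mem_cat in_cons.
  have -> : (k.+2 == k.+3) = false by clear; lia.
  congr (_ && _); apply: perm_cat_compl.
  by rewrite (perm_trans pw) // perm_sym perm_catC perm_parity_class.
have C' : unsorted_rigid k w' = false.
  rewrite /unsorted_rigid w'E left_part_cat //; apply/hasPn => p pF.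
  apply/negP => pp.
  have := rigid_splits_perm pF; have := rigid_splits_right_nonempty pF.
  case: p.2 => // x s _ /perm_size; rewrite size_cat -(perm_size pp) /=.
  rewrite !size_cat (perm_size pR) (perm_size pLb) (perm_size pLa) size_iota.
  have := perm_size pw; rewrite !size_cat size_iota; clear; lia.
have ule x : x \in La ++ Lb ++ R -> x <= k.+2 by rewrite mw mem_iota; clear; lia.
have leLa : {in La, forall x, x <= k.+2}.
  by move=> x xL; apply: ule; rewrite !mem_cat xL.
have leLb : {in Lb, forall x, x <= k.+2}.
  by move=> x xR; apply: ule; rewrite !mem_cat xR orbT.
have leR : {in R, forall x, x <= k.+2}.
  by move=> x xR; apply: ule; rewrite !mem_cat xR !orbT.
have k1alt : k.+1 \notin parity_class k by rewrite mem_parity_class; clear; lia.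
have B' : unsorted_desc k w' = false.
  rewrite /unsorted_desc [X in X && _](@perm_notin_r _ k.+3) //; last exact: mem_head.
  rewrite /left_part w'E index_cat !mem_cat TR TLb TLa -!mem_cat.
  have k2in' : k.+2 \in R ++ Lb ++ La by move: k2in; rewrite !mem_cat;
    case: (_ \in La); case: (_ \in Lb); case: (_ \in R).
  rewrite k2in' takel_cat; last by apply: index_size.
  by apply: contra k3w' => /mem_take.
have A' : unsorted_asc k w' = perm_eq (left_part k.+2 w') (parity_class k).
  rewrite /unsorted_asc w'E before_pivot // !mem_cat TR TLb TLa.
  by move: k1in; rewrite !mem_cat; case: (_ \in La); case: (_ \in Lb);
    case: (_ \in R); rewrite ?andbT.
rewrite /unsorted A B C A' B' C' !orbF orFb.
have [] := uniq_cat3P uw k2in => -[k2La k2Lb k2R].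
- have [u Lu pu] := revstack_last uLa k2La leLa.
  have -> : left_part k.+2 w' = revstack R ++ revstack Lb ++ u.
    have -> : w' = (revstack R ++ revstack Lb ++ u) ++ k.+2 :: [:: k.+3].
      by rewrite /w' Lu -!catA.
    rewrite left_part_cat // !mem_cat TR TLb !negb_or k2R k2Lb /=.
    by have := uLa; rewrite (perm_uniq pu) => /= /andP[].
  rewrite (@perm_notin_r _ k.+2) ?mem_head ?mem_cat ?negb_or ?k2Lb //=.
  rewrite (perm_notin_r k2R) ?mem_head //; apply/esym/(perm_notin _ k1alt).
  move: k1in; rewrite !mem_cat (perm_mem pu) TR TLb in_cons.
  by case: (_ \in u); case: (_ \in Lb); case: (_ \in R) => //=; clear; lia.
- have [u Lu pu] := revstack_last uLb k2Lb leLb.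
  have -> : left_part k.+2 w' = revstack R ++ u.
    rewrite /w' Lu -catA catA left_part_cat //.
    rewrite !mem_cat TR !negb_or k2R /=.
    by have := uLb; rewrite (perm_uniq pu) => /= /andP[].
  rewrite [X in _ || X](perm_notin_r k2R) ?mem_head // mem_cat k2Lb orbT andbT orbF.
  rewrite -[RHS](perm_cons k.+2) -parity_classSS.
  suff /permPl-> : perm_eq (Lb ++ R) (k.+2 :: revstack R ++ u) by [].
  apply/seq.permP => x.
  by move/seq.permP/(_ x): pu; move/seq.permP/(_ x): pR;
    rewrite /= ?count_cat /= ?count_cat /=; clear; lia.
- have [u Ru pu] := revstack_last uR k2R leR.
  have -> : left_part k.+2 w' = u.
    rewrite /w' Ru -catA left_part_cat //.
    by have := uR; rewrite (perm_uniq pu) => /= /andP[].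
  rewrite mem_cat (negPf k2La) (negPf k2Lb) andbF orFb.
  by rewrite (permPl pu) perm_cons.
Qed.

Lemma perm_iter_revstack t w : uniq w -> perm_eq (iter t revstack w) w.
Proof.
move=> uw; elim: t => //= t IHt.
by rewrite (perm_trans (perm_revstack _)) // (perm_uniq IHt).
Qed.

(** A maximum in last position stays there, so it can be dropped from the
    iteration. *)
Lemma iter_revstack_rcons t u m : uniq (rcons u m) -> {in u, forall x, x < m} ->
  iter t revstack (u ++ [:: m]) = iter t revstack u ++ [:: m].
Proof.
move=> uu um; rewrite cats1.
have uu' : uniq u by move: uu; rewrite rcons_uniq => /andP[].
elim: t => [|t IHt] /=; first by rewrite cats1.
rewrite IHt revstack_catE ?revstack0 //.
by rewrite cats0; apply/allP => x; rewrite (perm_mem (perm_iter_revstack t uu')) =>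
  /um.
Qed.

(** Since one pass fixes the last letter, [k + 1] passes on size [k + 4] amount to
    [k] passes on the image with its last letter removed. *)
Lemma unsortedP k w : perm_eq w (iota 1 k.+3) ->
  (iter k revstack w != iota 1 k.+3) = unsorted k w.
Proof.
elim: k w => [|k IHk] w pw.
  have : w \in permutations (iota 1 3) by rewrite mem_permutations.
  have /allP base :
    all (fun w => (w != iota 1 3) == unsorted 0 w) (permutations (iota 1 3)).
    by vm_compute.
  by move=> /base /eqP.
have uw : uniq w by rewrite (perm_uniq pw) iota_uniq.
have mw := perm_mem pw.
have k4w : k.+4 \in w by rewrite mw mem_iota; lia.
have le_k4 : {in w, forall x, x <= k.+4}.
  by move=> x; rewrite mw mem_iota; lia.
have [L [R [wE ltLR Tw]]] := revstack_max uw k4w le_k4.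
have pLR : perm_eq (L ++ R) (iota 1 k.+3).
  rewrite -(perm_cons k.+4) (permPr (perm_iotaS _)); apply/seq.permP => x.
  by move/seq.permP/(_ x): pw; rewrite wE /= !count_cat /=; lia.
have uLR : uniq (L ++ R) by rewrite (perm_uniq pLR) iota_uniq.
have [uL uR] : uniq L /\ uniq R.
  by move: uLR; rewrite cat_uniq => /and3P[].
have pT : perm_eq (revstack R ++ revstack L) (iota 1 k.+3).
  rewrite -(permPr pLR) perm_catC.
  by apply: perm_cat; apply: perm_revstack.
rewrite iterSr Tw catA iter_revstack_rcons; first last.
- by move=> x; rewrite (perm_mem pT) mem_iota; lia.
- by rewrite rcons_uniq (perm_uniq pT) iota_uniq (perm_mem pT) mem_iota; lia.
have -> : iota 1 k.+4 = iota 1 k.+3 ++ [:: k.+4].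
  by rewrite -(addn1 k.+3) iotaD add1n addn1.
(* Equality with the sorted word can be tested on the first k + 3 letters. *)
have sT : size (iter k revstack (revstack R ++ revstack L)) = k.+3.
  rewrite (perm_size (perm_iter_revstack _ _)) ?(perm_size pT) ?size_iota //.
  by rewrite (perm_uniq pT) iota_uniq.
rewrite eqseq_cat ?size_iota // eqxx andbT IHk //.
have : k.+3 \in L ++ R by rewrite (perm_mem pLR) mem_iota; lia.
have lt_k3 (s : seq nat) : {subset s <= iota 1 k.+2} -> all (gtn k.+3) s.
  by move=> sub; apply/allP => x /sub; rewrite mem_iota /=; lia.
rewrite mem_cat => /orP[kL|kR]; rewrite {}wE.
  case/splitPr: kL pLR {uL uR uLR Tw pT ltLR sT} => La Lb pLR.
  have pw' : perm_eq (La ++ Lb ++ R) (iota 1 k.+2).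
    rewrite -(perm_cons k.+3) (permPr (perm_iotaS _)); apply/seq.permP => x.
    by move/seq.permP/(_ x): pLR; rewrite /= ?count_cat /= ?count_cat /=; lia.
  rewrite -catA cat_cons unsorted_step_left // revstack_catE //.
  apply: lt_k3 => x xL; rewrite -(perm_mem pw') catA mem_cat xL //.
case/splitPr: kR pLR {uL uR uLR Tw pT ltLR sT} => Ra Rb pLR.
have pw' : perm_eq (L ++ Ra ++ Rb) (iota 1 k.+2).
  rewrite -(perm_cons k.+3) (permPr (perm_iotaS _)); apply/seq.permP => x.
  by move/seq.permP/(_ x): pLR; rewrite /= ?count_cat /= ?count_cat /=; lia.
rewrite unsorted_step_right // revstack_catE -?catA //.
apply: lt_k3 => x xL; rewrite -(perm_mem pw') mem_cat xL orbT //.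
Qed.

Import GRing.Theory.
Local Open Scope ring_scope.

(** * Descents and weights *)

(** Turns the cardinality that defines [des] into a recursion on words. *)
Lemma des_cons2 a b w : des (a :: b :: w) = ((b < a) + des (b :: w))%N.
Proof.
have desE u : des u = (\sum_(i < (size u).-1) (nth 0 u i.+1 < nth 0 u i))%N.
  by rewrite /des -sum1_card big_mkcond /=; apply: eq_bigr => i _; rewrite inE;
    case: ifP.
by rewrite !desE /= big_ord_recl.
Qed.

Lemma des1 a : des [:: a] = 0%N.
Proof. by rewrite /des (_ : [set _ | _] = set0) ?cards0 //; apply/setP=> -[]. Qed.

Lemma des_cat a u b v :
  des ((a :: u) ++ b :: v) = (des (a :: u) + (b < last a u) + des (b :: v))%N.
Proof.
elim: u a => [|c u IHu] a; first by rewrite /= des_cons2 des1.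
by rewrite [_ ++ _]/= des_cons2 -cat_cons IHu des_cons2 /= !addnA.
Qed.

(** The empty word has weight [1 = A_0], which the exponent [1 + des] alone
    would not give. *)
Definition wt (w : seq nat) : {poly rat} :=
  if w is [::] then 1 else 'X^(1 + des w).

(** The letter [m] creates one descent, to its right neighbour, which provides
    the [1 +] of the second factor; if [v] is empty that factor is [1].  With
    [u] empty the identity fails. *)
Lemma wt_peak u m v : u != [::] -> (last 0 u < m)%N -> (head 0 v < m)%N ->
  wt (u ++ m :: v) = wt u * wt v.
Proof.
case: u => // a u _ /= um; case: v => [_ | b v /= bm].
  by rewrite mulr1 -cat_cons des_cat des1 ltnNge (ltnW um) !addn0.
by rewrite -exprD -cat_cons des_cat des_cons2 ltnNge (ltnW um) bm; congr (_ ^+ _);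
  lia.
Qed.

Lemma des_map (f : nat -> nat) w :
  {in w &, {mono f : x y / (x < y)%N}} -> des (map f w) = des w.
Proof.
elim: w => // a [|b w] IHw fw; first by rewrite /= !des1.
rewrite [map _ _]/= !des_cons2 fw ?inE ?eqxx ?orbT //; congr (_ + _)%N.
by apply: IHw => x y xw yw; apply: fw; rewrite inE ?xw ?yw orbT.
Qed.

Lemma wt_map (f : nat -> nat) w :
  {in w &, {mono f : x y / (x < y)%N}} -> wt (map f w) = wt w.
Proof. by case: w => // a w /des_map; rewrite /wt /= => ->. Qed.

(** * Sums over arrangements of a set of letters *)

Lemma perm_words n :
  perm_eq [seq word s | s : 'S_n] (permutations (iota 1 n)).
Proof.
have word_inj : injective (@word n).
  move=> s t /eq_in_map st; apply/perm.permP => i.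
  by apply/val_inj/succn_inj/st; rewrite mem_enum.
apply: uniq_perm; first by rewrite map_inj_uniq ?enum_uniq.
  exact: permutations_uniq.
move=> w; rewrite mem_permutations; apply/mapP/idP => [[s _ ->]|pw].
  apply: uniq_perm; rewrite ?iota_uniq //.
    rewrite map_inj_uniq ?enum_uniq // => i j /succn_inj /val_inj.
    exact: perm_inj.
  move=> x; rewrite mem_iota; apply/mapP/idP => [[i _ ->]|].
    by have := ltn_ord (s i); lia.
  case: x => // x /andP[_ xn']; have xn : (x < n)%N by move: xn'; clear; lia.
  by exists ((s^-1)%g (Ordinal xn)); rewrite ?mem_enum // permKV.
have sw : size w = n by rewrite (perm_size pw) size_iota.
have wP (i : 'I_n) : ((nth 0%N w i).-1 < n)%N.
  have : nth 0%N w i \in w by rewrite mem_nth ?sw.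
  by rewrite (perm_mem pw) mem_iota; lia.
have wP1 (i : 'I_n) : (nth 0%N w i).-1.+1 = nth 0%N w i.
  have : nth 0%N w i \in w by rewrite mem_nth ?sw.
  by rewrite (perm_mem pw) mem_iota; lia.
pose f i := Ordinal (wP i).
have f_inj : injective f.
  move=> i j /(congr1 val) /= ij; apply/val_inj/eqP.
  have uw : uniq w by rewrite (perm_uniq pw) iota_uniq.
  have si (l : 'I_n) : (l < size w)%N by rewrite sw.
  rewrite -(nth_uniq 0%N (si i) (si j) uw).
  by rewrite -wP1 -[X in _ == X]wP1 ij.
pose s : 'S_n := perm f_inj.
exists s; first by rewrite mem_enum.
apply: (@eq_from_nth _ 0%N) => [|i]; first by rewrite size_map size_enum_ord.
rewrite sw => ltin; rewrite (nth_map (Ordinal ltin)) ?size_enum_ord //.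
by rewrite permE /= wP1 nth_enum_ord.
Qed.

(** Unlike permutations, the arrangements of a list of letters can be cut into
    subwords of the same kind, which is what the sums below rely on. *)
Lemma sum_words n (P : pred (seq nat)) (F : seq nat -> {poly rat}) :
  \sum_(s : 'S_n | P (word s)) F (word s) =
    \sum_(w <- permutations (iota 1 n) | P w) F w.
Proof. by rewrite -(perm_big _ (perm_words n)) big_map big_enum_cond. Qed.

Lemma wt_word n (s : 'S_n.+1) : wt (word s) = 'X^(1 + des (word s)).
Proof.
rewrite /wt; case E: (word s) => [|a u] //.
by have := congr1 size E; rewrite size_map size_enum_ord.
Qed.

(** Descents only depend on the relative order of the letters, so any set of
    letters can be replaced by an initial segment of the integers. *)
Lemma sum_wt (s : seq nat) :
  uniq s -> \sum_(w <- permutations s) wt w = eulerian (size s).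
Proof.
move=> us; wlog ss : s us / sorted leq s => [IH|].
  rewrite -(perm_big _ (perm_permutations (permEl (perm_sort leq s)))).
  rewrite IH ?size_sort ?sort_uniq //; exact/sort_sorted/leq_total.
have lts : sorted ltn s by rewrite ltn_sorted_uniq_leq us.
pose f i := nth 0%N s i.-1; pose g x := (index x s).+1.
have memi i : (i \in iota 1 (size s)) = (0 < i <= size s)%N.
  by rewrite mem_iota add1n ltnS.
have gf : {in iota 1 (size s), cancel f g}.
  move=> i; rewrite memi /f /g => /andP[i0 si].
  by rewrite index_uniq ?prednK.
have fg : {in s, cancel g f} by move=> x xs; rewrite /f /g nth_index.
have fh : {in iota 1 (size s) &, {homo f : x y / (x < y)%N}}.
  move=> x y; rewrite !memi /f => /andP[x0 xs] /andP[y0 ys] xy.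
  by apply: (sorted_ltn_nth ltn_trans); rewrite ?unfold_in /= ?prednK // -ltnS
    !prednK.
have fm : {in iota 1 (size s) &, {mono f : x y / (x < y)%N}}.
  move=> x y xs ys; case: (ltngtP x y) => [xy|yx|->]; rewrite ?ltnn //.
    exact: fh.
  by apply/negbTE; rewrite -leqNgt ltnW // fh.
have map_f : map f (iota 1 (size s)) = s.
  by rewrite (iotaDl 1 0) -map_comp -[RHS](mkseq_nth 0%N); apply: eq_map.
have ps : perm_eq (permutations s) (map (map f) (permutations (iota 1 (size s)))).
  apply: uniq_perm; first exact: permutations_uniq.
    rewrite map_inj_in_uniq ?permutations_uniq // => u v.
    rewrite !mem_permutations => /perm_mem pu /perm_mem pv uv.
    have gfK (t : seq nat) : t =i iota 1 (size s) -> map g (map f t) = t.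
      by move=> pt; rewrite -map_comp map_id_in // => x; rewrite pt => /gf.
    by rewrite -(gfK u) // uv gfK.
  move=> t; rewrite mem_permutations; apply/idP/mapP => [pt|[u]].
    exists (map g t).
      rewrite mem_permutations (permPl (perm_map g pt)) -{1}map_f -map_comp.
      by rewrite map_id_in.
    by rewrite -map_comp map_id_in // => x; rewrite (perm_mem pt) => /fg.
  by rewrite mem_permutations => pu ->; rewrite -[s in perm_eq _ s]map_f perm_map.
rewrite (perm_big _ ps) big_map /=.
transitivity (\sum_(w <- permutations (iota 1 (size s))) wt w).
  apply: eq_big_seq => w; rewrite mem_permutations => pw.
  by apply: wt_map => x y; rewrite !(perm_mem pw); apply: fm.
case: (size s) => [|n]; first by rewrite big_seq1.
by rewrite -(sum_words n.+1 predT wt); apply: eq_bigr => w _; rewrite wt_word.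
Qed.

Lemma notin_left_part m w : m \notin left_part m w.
Proof.
rewrite /left_part; elim: w => //= a w IHw; case: ifP => [//|am] /=.
by rewrite in_cons negb_or IHw eq_sym am.
Qed.

Lemma sum_split (F : seq nat -> {poly rat}) (s s1 s2 : seq nat) m :
  uniq s -> perm_eq s (s1 ++ m :: s2) ->
  \sum_(w <- permutations s | perm_eq (left_part m w) s1) F w =
  \sum_(u <- permutations s1) \sum_(v <- permutations s2) F (u ++ m :: v).
Proof.
move=> us ps; have : uniq (s1 ++ m :: s2) by rewrite -(perm_uniq ps).
rewrite cat_uniq /= negb_or => /and3P[_ /andP[ms1 _] _].
transitivity (\sum_(w <- [seq u ++ m :: v | u <- permutations s1,
                                            v <- permutations s2]) F w); last first.
  by rewrite big_allpairs_dep.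
rewrite -big_filter; apply: perm_big; apply: uniq_perm.
- by rewrite filter_uniq // permutations_uniq.
- apply: allpairs_uniq_dep; rewrite ?permutations_uniq //.
  move=> [u v] [u' v'] /allpairsPdep[a [b [au bv [-> ->]]]].
  move=> /allpairsPdep[a' [b' [au' bv' [-> ->]]]] /= E.
  rewrite !mem_permutations in au bv au' bv'.
  have ea : a = a'.
    rewrite -[a](@left_part_cat m a b) ?(perm_mem au) // E left_part_cat //.
    by rewrite (perm_mem au').
  by move: E; rewrite ea => /eqP; rewrite eqseq_cat // eqxx => /eqP[->].
move=> w; rewrite mem_filter mem_permutations; apply/andP/allpairsPdep.
  move=> [pl pw]; have mw : m \in w by rewrite (perm_mem pw) (perm_mem ps) mem_cat
    mem_head orbT.
  have uw : uniq w by rewrite (perm_uniq pw).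
  case/splitPr: mw pl pw uw => L R pl pw uw.
  have mL : m \notin L by move: uw; rewrite cat_uniq /= negb_or => /and3P[_ /andP[]].
  rewrite left_part_cat // in pl; exists L, R; rewrite !mem_permutations pl;
    split=> //.
  rewrite -(perm_cons m) -(perm_cat2l L) (perm_trans pw) // (perm_trans ps) //.
  by rewrite perm_cat2r perm_sym.
move=> [u [v []]]; rewrite !mem_permutations => pu pv ->.
rewrite left_part_cat ?(perm_mem pu) //; split=> //.
by rewrite perm_sym (perm_trans ps) // perm_sym perm_cat // perm_cons.
Qed.

Lemma sum_wt2 (s1 s2 : seq nat) : uniq s1 -> uniq s2 ->
  \sum_(u <- permutations s1) \sum_(v <- permutations s2) wt u * wt v =
  eulerian (size s1) * eulerian (size s2).
Proof.
by move=> u1 u2; rewrite -!sum_wt // mulr_suml; apply: eq_bigr => u _;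
  rewrite mulr_sumr.
Qed.

Definition right_part m (w : seq nat) := drop (index m w).+1 w.

Lemma right_part_cat m u v : m \notin u -> right_part m (u ++ m :: v) = v.
Proof.
by move=> mu; rewrite /right_part index_cat (negPf mu) /= eqxx addn0 -cat_rcons
  drop_size_cat // size_rcons.
Qed.

Lemma left_rightE m w : m \in w -> w = left_part m w ++ m :: right_part m w.
Proof.
move=> mw; rewrite /left_part /right_part -{1}(cat_take_drop (index m w) w).
by rewrite -{4}(nth_index 0%N mw) -drop_nth // index_mem.
Qed.

(** Words over [m :: s] are grouped by the set of letters to the left of [m]; the
    sides are then arbitrary arrangements of that set and its complement. *)
Lemma sum_sides (s : seq nat) m : uniq (m :: s) ->
  \sum_(w <- permutations (m :: s)) wt (left_part m w) * wt (right_part m w) =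
  \sum_(i < (size s).+1) 'C(size s, i)%:R *: (eulerian i * eulerian (size s - i)%N).
Proof.
move=> ums; have [ms us] : m \notin s /\ uniq s by move: ums => /= /andP[].
pose k := size s.
(* Subsets of the letters of s are encoded by sets of positions in s. *)
pose pick (S : {set 'I_k}) := [seq nth 0%N s (i : 'I_k) | i : 'I_k <- enum S].
have pick_inj : injective (fun i : 'I_k => nth 0%N s i).
  by move=> i j /eqP; rewrite nth_uniq // => /eqP/val_inj.
have pick_uniq S : uniq (pick S) by rewrite map_inj_uniq ?enum_uniq.
have mem_pick S x : (x \in pick S) = [exists i, (i \in S) && (nth 0%N s i == x)].
  apply/mapP/existsP => [[i] | [i /andP[iS /eqP <-]]].
    by rewrite mem_enum => iS ->; exists i; rewrite iS eqxx.
  by exists i => //; rewrite mem_enum.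
have pick_perm S : perm_eq s (pick S ++ pick (~: S)).
  apply: uniq_perm => //.
    rewrite cat_uniq !pick_uniq andbT; apply/hasPn => x.
    rewrite !mem_pick => /existsP[i /andP[iS /eqP<-]].
    apply/existsP => -[j /andP[jS /eqP/pick_inj ji]].
    by move: iS; rewrite inE -ji jS.
  move=> x; rewrite mem_cat !mem_pick; apply/idP/orP => [xs|].
    have ik : (index x s < k)%N by rewrite index_mem.
    have [iS|iS] := boolP (Ordinal ik \in S); [left|right]; apply/existsP;
      by exists (Ordinal ik); rewrite ?inE iS /= nth_index.
  by case=> /existsP[i /andP[_ /eqP<-]]; rewrite mem_nth.
pose left w := [set i : 'I_k | nth 0%N s i \in left_part m w].
have leftP w S : perm_eq w (m :: s) ->
    (left w == S) = perm_eq (left_part m w) (pick S).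
  move=> pw; have uw : uniq w by rewrite (perm_uniq pw).
  have ul : uniq (left_part m w) by rewrite take_uniq.
  have ml := notin_left_part m w.
  have ls x : x \in left_part m w -> x \in s.
    move=> xl; have := mem_take xl; rewrite (perm_mem pw) in_cons => /predU1P[xm|//].
    by rewrite xm (negPf ml) in xl.
  apply/eqP/idP => [<- | pl].
    apply: uniq_perm => // x; rewrite mem_pick; apply/idP/existsP => [xl|].
      have ik : (index x s < k)%N by rewrite index_mem ls.
      by exists (Ordinal ik); rewrite inE /= nth_index ?xl ?eqxx // ls.
    by case=> i /andP[]; rewrite inE => il /eqP <-.
  apply/setP => i; rewrite inE (perm_mem pl) mem_pick.
  apply/existsP/idP => [[j /andP[jS /eqP/pick_inj <-]] // | iS].
  by exists i; rewrite iS eqxx.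
have size_pick S : size (pick S) = #|S| by rewrite size_map cardE.
transitivity (\sum_(S : {set 'I_k}) eulerian #|S| * eulerian (k - #|S|)%N).
  under eq_bigr => w _ do rewrite -(big_pred1_eq +%R (left w)
    (fun=> wt (left_part m w) * wt (right_part m w))).
  rewrite (exchange_big_dep predT) //=; apply: eq_bigr => S _.
  rewrite big_seq_cond.
  under eq_bigl => w do rewrite mem_permutations eq_sym.
  under eq_bigl => w do rewrite (andb_id2l (leftP w S)) -mem_permutations.
  rewrite -big_seq_cond (@sum_split _ _ _ (pick (~: S))) //; last first.
    by rewrite perm_sym -cat1s perm_catCA cat1s perm_cons perm_sym.
  have -> : (k - #|S|)%N = size (pick (~: S)).
    by have := cardsC S; rewrite card_ord size_pick => /(canRL (addKn _)).
  rewrite -size_pick -sum_wt2 //; apply: eq_big_seq => u.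
  rewrite mem_permutations => pu; apply: eq_bigr => v _.
  have mu : m \notin u.
    rewrite (perm_mem pu); apply: contra ms => mp.
    by rewrite (perm_mem (pick_perm S)) mem_cat mp.
  by rewrite left_part_cat // right_part_cat.
have leSk (S : {set 'I_k}) : (#|S| < k.+1)%N by rewrite ltnS; have := max_card S;
  rewrite card_ord.
rewrite (partition_big (fun S => Ordinal (leSk S)) predT) //=.
apply: eq_bigr => i _.
rewrite (eq_bigr (fun=> eulerian i * eulerian (k - i)%N)) => [|S /eqP<- //].
rewrite sumr_const scaler_nat; congr (_ *+ _).
have := card_draws 'I_k i; rewrite card_ord => <-.
by apply: eq_card => S; rewrite !inE.
Qed.

(** If [a] is on the left of the maximum [m], the left part is nonempty and
    [wt_peak] applies.  Exchanging the sides of [m] is an involution that preserves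
    the product of their weights and moves [a] to the other side of [m], so the
    words with [a] on the left carry half of the total found in [sum_sides]. *)
Lemma sum_before (s : seq nat) m a : uniq (m :: s) -> all (gtn m) s -> a \in s ->
  \sum_(w <- permutations (m :: s) | before a m w) wt w =
    half_binom_conv (size s).+1.
Proof.
move=> ums sm as_; pose G w := wt (left_part m w) * wt (right_part m w).
pose swap w := right_part m w ++ m :: left_part m w.
have sidesP w : perm_eq w (m :: s) -> [/\ w = left_part m w ++ m :: right_part m w,
    m \notin right_part m w & (a \in left_part m w) = (a \notin right_part m w)].
  move=> pw; have mw : m \in w by rewrite (perm_mem pw) mem_head.
  have wE := left_rightE mw.
  have uw : uniq w by rewrite (perm_uniq pw).
  have aw : a \in w by rewrite (perm_mem pw) in_cons as_ orbT.
  have am : a != m by have := allP sm a as_; rewrite /= ltn_neqAle => /andP[].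
  move: uw aw; rewrite {1 2}wE cat_uniq /= mem_cat in_cons (negPf am) /=.
  rewrite negb_or => /and3P[_ /andP[_ /hasPn lr] /andP[mr _]] alr; split=> //.
  by move: alr (lr a) => /orP[] -> /=; case: (_ \in _) => // /(_ isT).
have beforeE w : perm_eq w (m :: s) -> before a m w = (a \in left_part m w).
  by move=> /sidesP[wE _ _]; rewrite {1}wE before_pivot // notin_left_part.
have swap_perm w : perm_eq w (m :: s) -> perm_eq (swap w) (m :: s).
  move=> pw; have [wE _ _] := sidesP w pw;
    rewrite -(permPr pw) [w in perm_eq _ w]wE /swap.
  by apply/seq.permP => x; rewrite !count_cat /=; clear; lia.
have swapK w : perm_eq w (m :: s) -> swap (swap w) = w.
  move=> /sidesP[wE mr _].
  by rewrite {1}/swap right_part_cat // left_part_cat // -wE.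
have swap_sum (P : pred (seq nat)) (H : seq nat -> {poly rat}) :
   \sum_(w <- permutations (m :: s) | P w) H w =
   \sum_(w <- permutations (m :: s) | P (swap w)) H (swap w).
  rewrite -(big_map swap P H); apply: perm_big; apply: uniq_perm.
  - exact: permutations_uniq.
  - rewrite map_inj_in_uniq ?permutations_uniq // => u v.
    by rewrite !mem_permutations => /swapK {2}<- /swapK {2}<- ->.
  move=> w; rewrite mem_permutations; apply/idP/mapP => [pw|[v]].
    by exists (swap w); rewrite ?mem_permutations ?swap_perm ?swapK.
  by rewrite mem_permutations => /swap_perm pv ->.
(* If the right part is empty, G still agrees with the weight; if the left one is,
   it does not, but then a is on the right. *)
transitivity (\sum_(w <- permutations (m :: s) | before a m w) G w).
  rewrite big_seq_cond [RHS]big_seq_cond; apply: eq_bigr => w.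
  rewrite mem_permutations => /andP[pw]; rewrite beforeE // => al.
  have [wE mr _] := sidesP w pw.
  have m0 : (0 < m)%N by have := allP sm a as_; rewrite /=; case: (m).
  have wm x : x \in w -> x != m -> (x < m)%N.
    rewrite (perm_mem pw) in_cons => /predU1P[->|xs _]; first by rewrite eqxx.
    exact: (allP sm).
  rewrite {1}wE wt_peak //.
  - by apply: contraTneq al => ->.
  - case: (left_part m w) al wE (notin_left_part m w) => // b l _ wE ml /=.
    apply: wm; first by rewrite wE mem_cat mem_last.
    by apply: contra ml => /eqP <-; apply: mem_last.
  - case: (right_part m w) mr wE => // b r mr wE /=.
    apply: wm; first by rewrite wE mem_cat !in_cons eqxx !orbT.
    by apply: contra mr => /eqP <-; apply: mem_head.
set X := LHS.
have XX : X + X = \sum_(i < (size s).+1)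
    'C(size s, i)%:R *: (eulerian i * eulerian (size s - i)%N).
  rewrite -(sum_sides ums) [RHS](bigID (before a m)) /=; congr (_ + _).
  rewrite /X swap_sum big_seq_cond [RHS]big_seq_cond.
  apply: eq_big => w; rewrite mem_permutations.
    have [pw|//] := boolP (perm_eq w (m :: s)).
    have [_ mr alr] /= := sidesP w pw.
    by rewrite (beforeE w) // alr negbK /swap before_pivot.
  move=> /andP[/sidesP[_ mr _] _].
  by rewrite /G /swap left_part_cat // right_part_cat // mulrC.
rewrite /half_binom_conv [_.+1.-1]/= -XX -mulr2n -scaler_nat scalerA.
by rewrite mul1r mulVf ?scale1r.
Qed.

(** * The contribution of the unsorted words *)

(** The recursion for splits exchanges the two sizes and increases one of them,
    so only two pairs of sizes occur, alternately. *)
Lemma sum_rigid_splits (f : nat -> nat -> {poly rat}) n :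
  \sum_(p <- rigid_splits n.+1) f (size p.1) (size p.2) =
    f n.+1./2 n./2 *+ n./2.+1 + f n.-1./2 n.+2./2 *+ n.+1./2.
Proof.
elim: n f => [|n IHn] f; first by rewrite big_seq1 mulr0n addr0.
rewrite rigid_splitsS big_cons big_map /= !size_parity_class.
rewrite (IHn (fun a b => f b a.+1)).
rewrite [in RHS]mulrS -addrA; congr (_ + _).
  by congr (f _ _); apply: (size_parity_class n.+1).
rewrite addrC; congr (_ + _).
by case: n {IHn} => [|n]; rewrite ?mulr0n.
Qed.

(** The left side determines the split: the split created last is the only one
    with [n - 1] on the left, and the others are determined one size down through
    their complements. *)
Lemma rigid_splits_inj n p q : p \in rigid_splits n -> q \in rigid_splits n ->
  perm_eq p.1 q.1 -> p = q.
Proof.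
have headN m (r : seq nat * seq nat) :
    r \in rigid_splits m -> perm_eq (parity_class m) r.2 = false.
  case: m => [//|m] rm; apply: (@perm_notin _ m.+1).
    by rewrite mem_parity_class eqxx leqnn.
  have : m.+1 \notin r.1 ++ r.2.
    by rewrite (perm_mem (rigid_splits_perm rm)) mem_iota; clear; lia.
  by rewrite mem_cat negb_or => /andP[].
elim: n p q => // n IHn p q; rewrite rigid_splitsS !in_cons.
move=> /predU1P[->|/mapP[p' p'n ->]] /predU1P[->|/mapP[q' q'n ->]] //=.
- by rewrite headN.
- by rewrite perm_sym headN.
move=> pq; rewrite (IHn p' q') //.
rewrite (@perm_cat_compl _ _ p'.2 _ q'.2) //.
by rewrite (perm_trans (rigid_splits_perm p'n)) // perm_sym rigid_splits_perm.
Qed.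

Lemma rigid_splits_uniq n : uniq (rigid_splits n).
Proof.
elim: n => // n IHn; rewrite rigid_splitsS cons_uniq map_inj_uniq ?IHn ?andbT.
  apply/mapP => -[r rn [E _]]; have : perm_eq (parity_class n) r.2 by rewrite E.
  case: n rn {IHn E} => [//|n] rn.
  apply/negP/negbT/(@perm_notin _ n.+1); first by rewrite mem_parity_class eqxx leqnn.
  have : n.+1 \notin r.1 ++ r.2.
    by rewrite (perm_mem (rigid_splits_perm rn)) mem_iota; clear; lia.
  by rewrite mem_cat negb_or => /andP[].
by move=> [a b] [c d] [-> ->].
Qed.

Lemma big_has_excl (T : eqType) (ps : seq T) (P : pred T) (x : {poly rat}) :
  uniq ps -> {in ps &, forall p q, P p -> P q -> p = q} ->
  (if has P ps then x else 0) = \sum_(p <- ps | P p) x.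
Proof.
move=> ups excl; case: hasP => [[p pps Pp] | noP].
  rewrite (big_rem p) //= Pp big_seq_cond big1 ?addr0 // => q.
  move=> /andP[]; rewrite mem_rem_uniq // inE => /andP[qp qps] Pq.
  by rewrite (excl q p) ?eqxx in qp.
by rewrite big_seq_cond big1 // => p /andP[pps Pp]; case: noP; exists p.
Qed.

(** The first two shapes prescribe different sizes for the part before [n - 1].
    In the first shape a rigid split would have to be the one with [n - 1] on the
    left, which has [n - 2] on the right, after [n].  In the second one none of
    [n - 1], [n - 2] and [n - 3] is on the left of [n], but every rigid split has
    one of them there.  Words of size [3] may have two shapes, for instance
    [321]. *)
Lemma unsorted_exclusive k w : perm_eq w (iota 1 k.+4) ->
  [&& ~~ (unsorted_asc k.+1 w && unsorted_desc k.+1 w),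
      ~~ (unsorted_asc k.+1 w && unsorted_rigid k.+1 w)
    & ~~ (unsorted_desc k.+1 w && unsorted_rigid k.+1 w)].
Proof.
move=> pw; have uw : uniq w by rewrite (perm_uniq pw) iota_uniq.
apply/and3P; split.
- apply/negP => /andP[/andP[/perm_size sA _] /andP[/perm_size sB _]].
  by move: sB; rewrite sA /=; clear; lia.
- have k4w : k.+4 \in w by rewrite (perm_mem pw) mem_iota; clear; lia.
  case/splitPr: k4w pw uw => L R pw uw.
  have pLR : perm_eq (L ++ R) (iota 1 k.+3).
    rewrite -(perm_cons k.+4) (permPr (perm_iotaS _)); apply/seq.permP => x.
    by move/seq.permP/(_ x): pw; rewrite /= ?count_cat /=; clear; lia.
  have k4L : k.+4 \notin L by move: uw; rewrite cat_uniq /= negb_or =>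
    /and3P[_ /andP[]].
  have [k3L|k3L] := boolP (k.+3 \in L).
    rewrite unsorted_rigid_left // /unsorted_asc before_pivot // -andbA.
    apply/negP => /and3P[_ k2L /perm_mem pL]; move: k2L.
    by rewrite pL mem_parity_class; clear; lia.
  apply/negP => /andP[/andP[lA _] _]; move: lA.
  apply/negP/negbT/(@perm_notin _ k.+4); last by rewrite mem_parity_class; clear; lia.
  rewrite /left_part index_cat (negPf k3L) /= (_ : (k.+4 == k.+3) = false);
    last by clear; lia.
  by rewrite addnS take_cat ltnNge ltnW ?ltnS ?leq_addr //= subSn ?leq_addr //=
    mem_cat mem_head orbT.
apply/negP => /andP[/andP[lB bB]].
have k3w : k.+3 \in w by rewrite (perm_mem pw) mem_iota; clear; lia.
case/splitPr: k3w pw uw lB bB => U Rb pw uw.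
have k3U : k.+3 \notin U by move: uw; rewrite cat_uniq /= negb_or =>
  /and3P[_ /andP[]].
rewrite left_part_cat // => pU.
have k4U : k.+4 \in U by rewrite (perm_mem pU) mem_head.
case/splitPr: k4U pw uw pU k3U => L Ra pw uw pU k3U.
rewrite -catA cat_cons in pw uw *.
have k4L : k.+4 \notin L by move: uw; rewrite cat_uniq /= negb_or =>
  /and3P[_ /andP[]].
have k3L : k.+3 \notin L by move: k3U; rewrite mem_cat negb_or => /andP[].
have pLR : perm_eq (L ++ Ra ++ k.+3 :: Rb) (iota 1 k.+3).
  rewrite -(perm_cons k.+4) (permPr (perm_iotaS _)); apply/seq.permP => x.
  by move/seq.permP/(_ x): pw; rewrite /= ?count_cat /= ?count_cat /=; clear; lia.
rewrite pivot_before //; last by clear; lia.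
move=> k1L; rewrite unsorted_rigid_right // => /hasP[p];
  rewrite rigid_splitsS in_cons.
move=> /predU1P[->|/mapP[q _ ->]] pL.
  have {}pL : L =i parity_class k.+1 := perm_mem pL.
  by move: k1L; rewrite pL mem_parity_class eqxx leqnn.
have k2L : k.+2 \in L by rewrite (perm_mem pL) mem_head.
have : k.+2 \in L ++ k.+4 :: Ra by rewrite mem_cat k2L.
by rewrite (perm_mem pU) in_cons mem_parity_class; clear; lia.
Qed.

Lemma sum_unsorted k (F : seq nat -> {poly rat}) :
  \sum_(w <- permutations (iota 1 k.+4) | unsorted k.+1 w) F w =
    \sum_(w <- permutations (iota 1 k.+4) | unsorted_asc k.+1 w) F w +
    \sum_(w <- permutations (iota 1 k.+4) | unsorted_desc k.+1 w) F w +
    \sum_(p <- rigid_splits k.+4)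
      \sum_(w <- permutations (iota 1 k.+4) | perm_eq (left_part k.+4 w) p.1) F w.
Proof.
rewrite (exchange_big_dep predT) //= big_mkcond.
rewrite (big_mkcond (unsorted_asc _)) (big_mkcond (unsorted_desc _)) -!big_split /=.
apply: eq_big_seq => w; rewrite mem_permutations => pw.
have excl : {in rigid_splits k.+4 &, forall p q, perm_eq (left_part k.+4 w) p.1 ->
    perm_eq (left_part k.+4 w) q.1 -> p = q}.
  move=> p q pn qn pp pq; apply: (rigid_splits_inj pn qn).
  by rewrite perm_sym in pp; apply: perm_trans pp pq.
rewrite -(big_has_excl (F w) (rigid_splits_uniq _) excl).
rewrite -/(unsorted_rigid k.+1 w) /unsorted; have := unsorted_exclusive pw.
by case: (unsorted_asc _ _) (unsorted_desc _ _) (unsorted_rigid _ _) =>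
  [] [] [] //= _; rewrite ?addr0 ?add0r.
Qed.

Lemma sum_before_parity_class n : (0 < n)%N ->
  \sum_(w <- permutations (parity_class n.+2) | before n n.+2 w) wt w =
    half_binom_conv (size (parity_class n.+2)).
Proof.
move=> n0; rewrite parity_classSS sum_before //.
- by rewrite -parity_classSS parity_class_uniq.
- by apply/allP => x; rewrite mem_parity_class /=; clear; lia.
by rewrite mem_parity_class n0 leqnn eqxx.
Qed.

(** The cut is at [n - 1].  Its right neighbour is not [n], as [n - 2] comes before
    [n], so [wt_peak] applies. *)
Lemma sum_unsorted_asc k :
  \sum_(w <- permutations (iota 1 k.+4) | unsorted_asc k.+1 w) wt w =
    eulerian (size (parity_class k.+1)) * half_binom_conv (size (parity_class k.+4)).
Proof.
pose F w := if before k.+2 k.+4 w then wt w else 0.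
transitivity (\sum_(w <- permutations (iota 1 k.+4) | perm_eq (left_part k.+3 w)
  (parity_class k.+1)) F w).
  rewrite big_mkcond [RHS]big_mkcond; apply: eq_bigr => w _.
  by rewrite /unsorted_asc /F; case: (perm_eq _ _).
rewrite (@sum_split _ _ _ (parity_class k.+4)) ?iota_uniq //; last first.
  rewrite perm_sym -(permPr (perm_parity_class k.+3)) [parity_class
    k.+3]parity_classSS.
  by apply/seq.permP => x; rewrite /= !count_cat /=; clear; lia.
rewrite -sum_before_parity_class // -sum_wt ?parity_class_uniq // mulr_suml.
apply: eq_big_seq => u; rewrite mem_permutations => pu.
rewrite mulr_sumr [RHS]big_mkcond; apply: eq_big_seq => v.
rewrite mem_permutations => pv.
rewrite /F before_shift; first last.
- by rewrite in_cons (perm_mem pu) mem_parity_class; clear; lia.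
- by rewrite in_cons (perm_mem pu) mem_parity_class; clear; lia.
case: ifP => // bv; apply: wt_peak.
- by rewrite -size_eq0 (perm_size pu) size_parity_class.
- case: u pu => [/perm_size|b u pu]; first by rewrite size_parity_class.
  have : last b u \in parity_class k.+1 by rewrite -(perm_mem pu) mem_last.
  by rewrite mem_parity_class /=; clear; lia.
case: v pv bv => [|b v] //= pv bv.
have : b \in parity_class k.+4 by rewrite -(perm_mem pv) mem_head.
have : b != k.+4 by apply: contraTneq bv => ->; rewrite /before /= eqxx.
by rewrite mem_parity_class; clear; lia.
Qed.

(** The cut is again at [n - 1].  Its left neighbour is not [n], as [n - 3] comes
    after [n].  The order condition is the opposite of that of [sum_before]. *)
Lemma sum_unsorted_desc k :
  \sum_(w <- permutations (iota 1 k.+4) | unsorted_desc k.+1 w) wt w =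
    (eulerian (size (parity_class k.+3))
       - half_binom_conv (size (parity_class k.+3))) *
    eulerian (size (parity_class k.+2)).
Proof.
pose s := k.+4 :: parity_class k.+1.
pose F w := if before k.+4 k.+1 w then wt w else 0.
transitivity (\sum_(w <- permutations (iota 1 k.+4) | perm_eq (left_part k.+3 w) s)
  F w).
  rewrite big_mkcond [RHS]big_mkcond; apply: eq_bigr => w _.
  by rewrite /unsorted_desc /F; case: (perm_eq _ _).
rewrite (@sum_split _ _ _ (parity_class k.+2)) ?iota_uniq //; last first.
  rewrite perm_sym -(permPr (perm_parity_class k.+3)) [parity_class
    k.+4]parity_classSS [parity_class k.+3]parity_classSS.
  by apply/seq.permP => x; rewrite /= !count_cat /=; clear; lia.
have us : uniq s by rewrite /s cons_uniq parity_class_uniq mem_parity_class andbT;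
  clear; lia.
have -> : eulerian (size (parity_class k.+3))
    - half_binom_conv (size (parity_class k.+3)) =
    \sum_(u <- permutations s | before k.+4 k.+1 u) wt u.
  have -> : size (parity_class k.+3) = size s by [].
  rewrite -sum_wt // -(@sum_before (parity_class k.+1) k.+4 k.+1) //; first last.
  - by rewrite mem_parity_class eqxx leqnn.
  - by apply/allP => x; rewrite mem_parity_class /=; clear; lia.
  rewrite [X in X - _](bigID (before k.+1 k.+4)) /= addrAC subrr add0r.
  rewrite big_seq_cond [RHS]big_seq_cond; apply: eq_bigl => u.
  rewrite mem_permutations; have [pu|//] := boolP (perm_eq u s).
  have k1u : k.+1 \in u by rewrite (perm_mem pu) in_cons mem_parity_class eqxx
    leqnn orbT.
  rewrite /before -leqNgt leq_eqVlt; case: eqP => // E.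
  have k4u : k.+4 \in u by rewrite (perm_mem pu) mem_head.
  by have := congr1 (nth 0%N u) E; rewrite !nth_index //; clear; lia.
rewrite -sum_wt ?parity_class_uniq // mulr_suml [RHS]big_mkcond /=.
apply: eq_big_seq => u; rewrite mem_permutations => pu.
have uu : uniq u by rewrite (perm_uniq pu).
have k1u : k.+1 \in u by rewrite (perm_mem pu) in_cons mem_parity_class eqxx leqnn
  orbT.
have k4u : k.+4 \in u by rewrite (perm_mem pu) mem_head.
case: ifP => bu; last first.
  by apply: big1 => v _; rewrite /F before_cat2 // bu.
rewrite mulr_sumr; apply: eq_big_seq => v; rewrite mem_permutations => pv.
rewrite /F before_cat2 // bu; apply: wt_peak.
- by apply: contraTneq k1u => ->.
- case/lastP: u pu uu k1u k4u bu => // u b pu uu k1u _ bu; rewrite last_rcons.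
  have : b \in s by rewrite -(perm_mem pu) mem_rcons mem_head.
  have : b != k.+4.
    apply: contraTneq bu => bE; move: uu k1u; rewrite bE rcons_uniq mem_rcons in_cons.
    move=> /andP[k4u _] /predU1P[|k1u]; first by clear; lia.
    by rewrite -cats1 pivot_before ?k1u //; clear; lia.
  by rewrite /s in_cons mem_parity_class; clear; lia.
case: v pv => [|b v] //= pv.
have : b \in parity_class k.+2 by rewrite -(perm_mem pv) mem_head.
by rewrite mem_parity_class; clear; lia.
Qed.

Lemma sum_unsorted_rigid k (p : seq nat * seq nat) : p \in rigid_splits k.+4 ->
  \sum_(w <- permutations (iota 1 k.+4) | perm_eq (left_part k.+4 w) p.1) wt w =
    eulerian (size p.1) * eulerian (size p.2).
Proof.
move=> pF; have pp := rigid_splits_perm pF.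
have up : uniq (p.1 ++ p.2) by rewrite (perm_uniq pp) iota_uniq.
have [u1 u2] : uniq p.1 /\ uniq p.2 by move: up; rewrite cat_uniq => /and3P[].
have lep x : x \in p.1 ++ p.2 -> (x < k.+4)%N.
  by rewrite (perm_mem pp) mem_iota; clear; lia.
have p1_0 : p.1 != [::].
  move: pF; rewrite rigid_splitsS in_cons => /predU1P[->|/mapP[q qF ->]].
    by rewrite -size_eq0 size_parity_class.
  exact: rigid_splits_right_nonempty qF.
rewrite (@sum_split _ _ _ p.2) ?iota_uniq //; last first.
  rewrite -(permPl (perm_iotaS _)); apply/seq.permP => x.
  by move/seq.permP/(_ x): pp; rewrite /= !count_cat /=; clear; lia.
rewrite -sum_wt2 //; apply: eq_big_seq => u; rewrite mem_permutations => pu.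
apply: eq_big_seq => v; rewrite mem_permutations => pv; apply: wt_peak.
- by rewrite -size_eq0 (perm_size pu) size_eq0.
- case: u pu => [/perm_size/esym/eqP|b u pu]; first by rewrite size_eq0 (negPf p1_0).
  by apply: (lep (last b u)); rewrite mem_cat -(perm_mem pu) mem_last.
case: v pv => [|b v] pv //=.
by apply: lep; rewrite mem_cat -(perm_mem pv) mem_head orbT.
Qed.

(** For even [n] the two kinds of rigid split give the same product, so that
    their multiplicities may be redistributed. *)
Lemma collect_terms (R : comNzRingType) (A D : nat -> R) k :
  A k.+4 - (A (uphalf k.+1) * D (uphalf k.+4) +
    (A (uphalf k.+3) - D (uphalf k.+3)) * A (uphalf k.+2) +
    (A k.+4./2 * A k.+3./2 *+ k.+3./2.+1 +
     A k.+3.-1./2 * A k.+3.+2./2 *+ k.+4./2)) =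
  A k.+4 - A ((k.+4 - 1)./2)%N * A (uphalf (k.+4 - 1)%N)
    - ((k.+4 + 2)./2)%N%:R * A ((k.+4 - 1)./2)%N * A (k.+4./2)%N
    - ((k.+4 - 1)./2)%N%:R * A ((k.+4 - 2)./2)%N * A ((k.+4 + 1)./2)%N
    + A ((k.+4 - 1)./2)%N * D (k.+4./2)%N
    - A ((k.+4 - 2)./2)%N * D ((k.+4 + 1)./2)%N.
Proof.
rewrite subn1 subn2 addn1 addn2 /= uphalf_half.
by case: (odd k); rewrite ?add0n ?add1n; ring.
Qed.

Theorem theorem3p4 (n : nat) (n_gt3 : (3 < n)%N) :
  let A := eulerian in
  let D := half_binom_conv in
  \sum_(s : 'S_n | iter (n - 3)%N revstack (word s) == id_word n)
      'X^(1 + des (word s)) =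
    A n - A ((n - 1)./2)%N * A (uphalf (n - 1)%N)
    - ((n + 2)./2)%N%:R * A ((n - 1)./2)%N * A (n./2)%N
    - ((n - 1)./2)%N%:R * A ((n - 2)./2)%N * A ((n + 1)./2)%N
    + A ((n - 1)./2)%N * D (n./2)%N
    - A ((n - 2)./2)%N * D ((n + 1)./2)%N.
Proof.
move=> A D; case: n n_gt3 => [|[|[|[|k]]]] // _.
have -> : (k.+4 - 3 = k.+1)%N by clear; lia.
pose good w := iter k.+1 revstack w == iota 1 k.+4.
transitivity (\sum_(w <- permutations (iota 1 k.+4) | good w) wt w).
  by rewrite -sum_words; apply: eq_bigr => s _; rewrite wt_word.
transitivity (A k.+4 - \sum_(w <- permutations (iota 1 k.+4) | unsorted k.+1 w) wt w).
  rewrite /A -{2}[k.+4](size_iota 1) -sum_wt ?iota_uniq //.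
  rewrite [in RHS](bigID good) /= -[LHS]addr0 -addrA; congr (_ + _).
  apply/esym/eqP; rewrite subr_eq0; apply/eqP.
  rewrite big_seq_cond [RHS]big_seq_cond; apply: eq_bigl => w.
  by rewrite mem_permutations; case: (boolP (perm_eq w _)) => //= pw;
    rewrite -unsortedP.
rewrite sum_unsorted sum_unsorted_asc sum_unsorted_desc.
rewrite (eq_big_seq _ (@sum_unsorted_rigid k)) !size_parity_class.
have -> := sum_rigid_splits (fun a b => eulerian a * eulerian b) k.+3.
exact: collect_terms.
Qed.
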